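(* Let $t\in(0,1)$. Let $a\in A$ and $b\in B$, and write $\Delta(a)=\sum_i a_i'\otimes a_i''\in A\otimes A$ and $\widetilde\Delta(b)=\sum_j c_j\otimes d_j\in A\otimes B$ as finite sums of pure tensors. Then $$\widetilde\Delta(\pi(a)b)=\sum_{i,j}\xi(a_i')\,c_j\otimes\pi(a_i'')\,d_j.$$ (In Sweedler notation: $\widetilde\Delta(\pi(a)b)=\xi(a_{(1)})b_{(1)}\otimes\pi(a_{(2)})b_{(2)}$, where $\Delta(a)=a_{(1)}\otimes a_{(2)}$ and $\widetilde\Delta(b)=b_{(1)}\otimes b_{(2)}$.)
   Context: $\mathrm{Sym}=\mathbb{R}[p_1,p_2,\dots]$ is the graded algebra of symmetric functions over $\mathbb{R}$, with $p_k$ the Newton power sums ($\deg p_k=k$). For a partition $\kappa$, $m_i(\kappa)$ is the number of parts equal to $i$ and $p_\kappa:=\prod_{i\ge 1}p_i^{m_i(\kappa)}$. The Hall-Littlewood inner product with parameter $u\in(-1,1)$ on $\mathrm{Sym}$ is $\langle p_\kappa,p_\rho\rangle_u=\delta_{\kappa\rho}z_\kappa(u)$, where $z_\kappa(u)=z_\kappa\prod_{i\ge1}(1-u^i)^{-m_i(\kappa)}$ and $z_\kappa=\prod_{i\ge1}i^{m_i(\kappa)}m_i(\kappa)!$. $A$ and $B$ are two copies of $\mathrm{Sym}$, equipped with the inner products $\langle\cdot,\cdot\rangle_{t^2}$ and $\langle\cdot,\cdot\rangle_{-t}$ respectively. $\pi:\mathrm{Sym}\to\mathrm{Sym}$ is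 the algebra endomorphism with $\pi(p_k)=p_{2k}$ for all $k\ge1$ (for $a\in A$, $\pi(a)$ is regarded as an element of $B=\mathrm{Sym}$). The $p_2$-twisted comultiplication $\widetilde\Delta:B\to A\otimes B$ is the linear map dual to $A\otimes B\to B$, $a\otimes b\mapsto\pi(a)b$, with respect to these inner products, i.e. $\langle\widetilde\Delta(b),a\otimes b'\rangle_{A\otimes B}=\langle b,\pi(a)b'\rangle_{-t}$, where $\langle a_1\otimes b_1,a_2\otimes b_2\rangle_{A\otimes B}=\langle a_1,a_2\rangle_{t^2}\langle b_1,b_2\rangle_{-t}$. $\Delta:A\to A\otimes A$ is the standard comultiplication of $\mathrm{Sym}$: the algebra morphism with $\Delta(p_k)=p_k\otimes1+1\otimes p_k$ for all $k\ge1$. $\xi:=\mathrm{m}\circ\Delta:A\to A$, where $\mathrm{m}:A\otimes A\to A$ is the multiplication; thus $\xi$ is the algebra morphism with $\xi(p_k)=2p_k$ for all $k\ge1$. *)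

(* Defs.v *)
From HB Require Import structures.
From mathcomp Require Import all_boot all_order all_algebra.
From mathcomp Require Import finmap monalg reals.

Set Implicit Arguments.
Unset Strict Implicit.
Unset Printing Implicit Defensive.

Import Order.TTheory GRing.Theory Num.Theory.

Local Open Scope ring_scope.

(* A partition is encoded by its multiplicities, with indices shifted by one:
   for kap : partition, kap i is m_{i+1}(kap), the number of parts equal to
   i.+1.  The monoid law is the union of partitions (as multisets of parts). *)
Notation partition := {cmonom nat}.

(* Sym = R[p_1, p_2, ...]; the basis vector << kap >> is p_kap
   (see psum_partE). *)
Notation Sym R := {malg R[partition]}.

(* The product monoid: its algebra is the tensor product of the algebras of
   the two factors (see tensor_universal and tensorM). *)
Section ProdMonomial.
Variables M N : conomType.

Definition pmone : M * N := (mone, mone).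
Definition pmmul (x y : M * N) : M * N := (mmul x.1 y.1, mmul x.2 y.2).

Fact pmmulA : associative pmmul.
Proof. by move=> x y z; rewrite /pmmul /= !mulmA. Qed.

Fact pmmul1m : left_id pmone pmmul.
Proof. by case=> x y; rewrite /pmmul /= !mul1m. Qed.

Fact pmmulm1 : right_id pmone pmmul.
Proof. by case=> x y; rewrite /pmmul /= !mulm1. Qed.

Fact pmunit x y : pmmul x y = pmone -> x = pmone /\ y = pmone.
Proof. by case: x y => [a b] [c d] [/unitm[-> ->] /unitm[-> ->]]. Qed.

Fact pmmulC : commutative pmmul.
Proof. by move=> x y; rewrite /pmmul (mulmC x.1) (mulmC x.2). Qed.

HB.instance Definition _ :=
  Choice_isMonomialDef.Build (M * N)%type pmmulA pmmul1m pmmulm1 pmunit.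
HB.instance Definition _ := MonomialDef_isConomialDef.Build (M * N)%type pmmulC.
End ProdMonomial.

Notation SymSym R := {malg R[(partition * partition)%type]}.

(* Locked only to keep unification from unfolding it; see mcoeff_tensor. *)
HB.lock Definition tensor (R : comNzRingType) (a b : Sym R) : SymSym R :=
  \sum_(k <- msupp a) \sum_(l <- msupp b) << a@_k * b@_l *g (k, l) >>.

Section PowerSums.
Variable R : comNzRingType.

(* p_k for k >= 1 (the value psum 0 = p_1 is junk and never used). *)
Definition psum (k : nat) : Sym R := << ucm k.-1 >>.

(* multS is the multiplication map Sym ⊗ Sym -> Sym (see multS_tensor). *)
Definition multpart (q : partition * partition) : Sym R :=
  << q.1 >> * << q.2 >>.

Lemma monalgUM (M : monomType) (k l : M) :
  << mmul k l >> = << k >> * << l >> :> {malg R[M]}.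
Proof. by rewrite malgM_def fgmulUU mulr1. Qed.

Fact multpart_mmorphism : mmorphism multpart.
Proof.
split=> [k l|]; last exact: mulr1.
rewrite /multpart [in LHS]monalgUM [X in _ * X = _]monalgUM.
exact: mulrACA.
Qed.

HB.instance Definition _ :=
  isMultiplicative.Build (partition * partition)%type (Sym R)
    multpart multpart_mmorphism.

Definition multS : SymSym R -> Sym R := mmap (in_alg (Sym R)) multpart.

HB.instance Definition _ := GRing.RMorphism.copy multS
  (mmap (in_alg (Sym R)) multpart).

Fact multS_is_scalable : scalable_for *:%R multS.
Proof. by move=> c a; rewrite /multS mmapZ /= mulr_algl. Qed.

HB.instance Definition _ :=
  GRing.isScalable.Build R (SymSym R) (Sym R) *:%R multS multS_is_scalable.

End PowerSums.

Arguments psum {R} k.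

Notation "a ⊗ b" := (tensor a b) (at level 40, left associativity) : ring_scope.

(* The algebra morphism Sym -> S sending p_k to x k for all k >= 1. *)
Section Substitution.
Variables (R : comNzRingType) (S : comAlgType R) (x : nat -> S).

Definition partsubst (kap : partition) : S :=
  \prod_(i <- finsupp kap) x i.+1 ^+ kap i.

Lemma partsubstEw (d : {fset nat}) (kap : partition) :
  (finsupp kap `<=` d)%fset ->
  partsubst kap = \prod_(i <- d) x i.+1 ^+ kap i.
Proof.
move=> le; rewrite [LHS](big_fset_incl _ le) //= => i _.
by rewrite -cmE_eq0 => /eqP->; rewrite expr0.
Qed.

Fact partsubst_mmorphism : mmorphism partsubst.
Proof.
split=> [k l|]; last by rewrite /partsubst mdom1 big_seq_fset0.
rewrite [LHS]/partsubst mdomD (partsubstEw (fsubsetUl _ (finsupp l))).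
rewrite (partsubstEw (fsubsetUr (finsupp k) _)) -big_split /=.
by apply: eq_bigr => i _; rewrite cmM exprD.
Qed.

HB.instance Definition _ :=
  isMultiplicative.Build partition S partsubst partsubst_mmorphism.

Definition symsubst : Sym R -> S := mmap (in_alg S) partsubst.

HB.instance Definition _ := GRing.RMorphism.copy symsubst
  (mmap (in_alg S) partsubst).

Fact symsubst_is_scalable : scalable_for *:%R symsubst.
Proof. by move=> c a; rewrite /symsubst mmapZ /= mulr_algl. Qed.

HB.instance Definition _ :=
  GRing.isScalable.Build R (Sym R) S *:%R symsubst symsubst_is_scalable.

Lemma symsubstU kap : symsubst << kap >> = partsubst kap.
Proof. by rewrite /symsubst mmapU /= scale1r mul1r. Qed.

Lemma symsubst_psum k : (0 < k)%N -> symsubst (psum k) = x k.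
Proof.
case: k => // k _; rewrite symsubstU /partsubst mdomU big_seq_fset1.
by rewrite cmUU expr1.
Qed.

End Substitution.

Lemma prod_psum (R : comNzRingType) (r e : nat -> nat) (s : seq nat) :
    injective r -> uniq s ->
  exists2 m : partition,
    \prod_(i <- s) psum (r i).+1 ^+ e i = << m >> :> Sym R
    & forall j, m (r j) = if j \in s then e j else 0%N.
Proof.
move=> inj_r; elim: s => [|i s IH] /=.
  by exists mone => [|j]; rewrite ?big_nil ?cm1.
case/andP=> nis /IH[m Em mE].
have [n En nE] : exists2 n : partition,
    psum (r i).+1 ^+ e i = << n >> :> Sym R
    & forall j, n (r j) = if j == i then e i else 0%N.
  elim: (e i) => [|f [n En nE]].
    by exists mone => [|j]; [exact: expr0|rewrite cm1 if_same].
  exists (mmul (ucm (r i)) n) => [|j]; first by rewrite exprS En monalgUM.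
  by rewrite cmM cmU nE (inj_eq inj_r) eq_sym; case: eqP.
exists (mmul n m) => [|j]; first by rewrite monalgUM -En -Em big_cons.
rewrite cmM nE mE inE; case: eqVneq => //= ->.
by rewrite (negbTE nis) addn0.
Qed.

(* p_kap is the product of the p_i ^ m_i(kap). *)
Lemma psum_partE (R : comNzRingType) (kap : partition) :
  << kap >> = \prod_(i <- finsupp kap) psum i.+1 ^+ kap i :> Sym R.
Proof.
have [m -> mE] := prod_psum R kap (@inj_id nat) (fset_uniq (finsupp kap)).
congr (<< _ >>); apply/eqP/cmP => j; rewrite (mE j).
by case: mdomP.
Qed.

Section TensorTheory.
Variable R : comNzRingType.
Implicit Types a b : Sym R.

Lemma mcoeff_tensor a b k l : (a ⊗ b)@_(k, l) = a@_k * b@_l.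
Proof.
rewrite unlock {3}[a]monalgE {3}[b]monalgE !raddf_sum mulr_suml.
apply: eq_bigr => i _; rewrite raddf_sum mulr_sumr; apply: eq_bigr => j _.
rewrite /= !mcoeffU xpair_eqE.
by do 2!case: eqP => _; rewrite ?(mulr0n, mulr1n, mulr0, mul0r).
Qed.

Lemma tensorDl a1 a2 b : (a1 + a2) ⊗ b = a1 ⊗ b + a2 ⊗ b.
Proof.
by apply/malgP=> -[k l]; rewrite [RHS]mcoeffD !mcoeff_tensor mcoeffD mulrDl.
Qed.

Lemma tensorDr a b1 b2 : a ⊗ (b1 + b2) = a ⊗ b1 + a ⊗ b2.
Proof.
by apply/malgP=> -[k l]; rewrite [RHS]mcoeffD !mcoeff_tensor mcoeffD mulrDr.
Qed.

Lemma tensorZl c a b : (c *: a) ⊗ b = c *: (a ⊗ b).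
Proof. by apply/malgP=> -[k l]; rewrite [RHS]mcoeffZ !mcoeff_tensor mcoeffZ mulrA. Qed.

Lemma tensorZr c a b : a ⊗ (c *: b) = c *: (a ⊗ b).
Proof.
by apply/malgP=> -[k l]; rewrite [RHS]mcoeffZ !mcoeff_tensor mcoeffZ mulrCA.
Qed.

Lemma tensorU (k l : partition) : << k >> ⊗ << l >> = << (k, l) >> :> SymSym R.
Proof.
apply/malgP=> -[i j]; rewrite mcoeff_tensor !mcoeffU xpair_eqE.
by do 2!case: eqP => _; rewrite ?(mulr0n, mulr1n, mulr0, mul0r, mulr1).
Qed.

Lemma tensor0l b : 0 ⊗ b = 0.
Proof. by rewrite -(scale0r (0 : Sym R)) tensorZl scale0r. Qed.

Lemma tensor0r a : a ⊗ 0 = 0.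
Proof. by rewrite -(scale0r (0 : Sym R)) tensorZr scale0r. Qed.

Lemma malg_linind (K : choiceType) (P : {malg R[K]} -> Prop) :
    P 0 -> (forall x y, P x -> P y -> P (x + y)) ->
    (forall c x, P x -> P (c *: x)) -> (forall k, P << k >>) ->
  forall x, P x.
Proof.
move=> P0 PD PZ PU x; rewrite [x]monalgE; apply: big_ind => // k _.
have -> : << x@_k *g k >> = x@_k *: << k >> :> {malg R[K]}.
  by apply/malgP=> l; rewrite mcoeffZ !mcoeffU mulrnAr mulr1.
exact/PZ/PU.
Qed.

Lemma malg_linear_ext (K : choiceType) (V : lmodType R)
    (f g : {linear {malg R[K]} -> V}) :
  (forall k, f << k >> = g << k >>) -> f =1 g.
Proof.
move=> fg; apply: malg_linind => // [|x y fx fy|c x fx].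
- by rewrite !linear0.
- by rewrite !linearD fx fy.
- by rewrite !linearZ fx.
Qed.

Lemma tensorM a b a' b' : (a ⊗ b) * (a' ⊗ b') = (a * a') ⊗ (b * b').
Proof.
elim/malg_linind: a => [|x y Hx Hy|c x Hx|k].
- by rewrite [0 * a']mul0r !tensor0l [LHS]mul0r.
- by rewrite mulrDl !tensorDl mulrDl Hx Hy.
- by rewrite tensorZl -[LHS]scalerAl Hx -[(c *: x) * a']scalerAl tensorZl.
move Ek: << k >> => u.
elim/malg_linind: b => [|x y Hx Hy|c x Hx|l].
- by rewrite [0 * b']mul0r !tensor0r [LHS]mul0r.
- by rewrite [_ * b']mulrDl !tensorDr mulrDl Hx Hy.
- by rewrite tensorZr -[LHS]scalerAl Hx -[(c *: x) * b']scalerAl tensorZr.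
move El: << l >> => v.
elim/malg_linind: a' => [|x y Hx Hy|c x Hx|k'].
- by rewrite [u * 0]mulr0 !tensor0l [LHS]mulr0.
- by rewrite [u * _]mulrDr !tensorDl mulrDr Hx Hy.
- by rewrite tensorZl -[LHS]scalerAr Hx -[_ * (c *: x)]scalerAr tensorZl.
move Ek': << k' >> => u'.
elim/malg_linind: b' => [|x y Hx Hy|c x Hx|l'].
- by rewrite [v * 0]mulr0 !tensor0r [LHS]mulr0.
- by rewrite [v * _]mulrDr !tensorDr mulrDr Hx Hy.
- by rewrite tensorZr -[LHS]scalerAr Hx -[_ * (c *: x)]scalerAr tensorZr.
rewrite -Ek -El -Ek'.
transitivity (<< mmul k k' >> ⊗ << mmul l l' >> : SymSym R); last first.
  exact: (congr2 (@tensor R) (monalgUM R k k') (monalgUM R l l')).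
apply: etrans (congr2 *%R (tensorU k l) (tensorU k' l')) _.
apply: etrans _ (esym (tensorU (mmul k k') (mmul l l'))).
exact: esym (monalgUM R (k, l) (k', l')).
Qed.

(* SymSym R, with tensor, is the tensor product of Sym R with itself. *)
Lemma tensor_universal (V : lmodType R) (f : Sym R -> Sym R -> V) :
    (forall c a a' b, f (c *: a + a') b = c *: f a b + f a' b) ->
    (forall c a b b', f a (c *: b + b') = c *: f a b + f a b') ->
  exists2 g : {linear SymSym R -> V}, forall a b, g (a ⊗ b) = f a b
    & forall h : {linear SymSym R -> V},
        (forall a b, h (a ⊗ b) = f a b) -> h =1 g.
Proof.
move=> fl fr.
pose g x := \sum_(q <- msupp x) x@_q *: f << q.1 >> << q.2 >>.
have gEw (d : {fset partition * partition}) x : (msupp x `<=` d)%fset ->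
    g x = \sum_(q <- d) x@_q *: f << q.1 >> << q.2 >>.
  move=> le; rewrite [LHS](big_fset_incl _ le) //= => q _ /mcoeff_outdom ->.
  by rewrite scale0r.
have gP : linear g.
  move=> c x y; set d := (msupp x `|` msupp y)%fset.
  rewrite (gEw d) ?(gEw d x) ?(gEw d y) ?fsubsetUl ?fsubsetUr //; last first.
    apply/fsubsetP => q /(fsubsetP (msuppD_le _ _)); rewrite !in_fsetU.
    by case/orP => [/(fsubsetP (msuppZ_le _ _))->//|->]; rewrite orbT.
  rewrite scaler_sumr -big_split; apply: eq_bigr => q _ /=.
  by rewrite mcoeffD mcoeffZ scalerDl scalerA.
pose gL := GRing.isLinear.Build R (SymSym R) V *:%R g gP.
pose G : {linear SymSym R -> V} := HB.pack g gL.
have gU q : g << q >> = f << q.1 >> << q.2 >>.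
  by rewrite /g msuppU1 big_seq_fset1 mcoeffUU scale1r.
have f0l b : f 0 b = 0.
  by have := fl (-1) 0 0 b; rewrite scaler0 addr0 scaleN1r addNr.
have f0r a : f a 0 = 0.
  by have := fr (-1) a 0 0; rewrite scaler0 addr0 scaleN1r addNr.
have fDl a a' b : f (a + a') b = f a b + f a' b.
  by have := fl 1 a a' b; rewrite !scale1r.
have fDr a b b' : f a (b + b') = f a b + f a b'.
  by have := fr 1 a b b'; rewrite !scale1r.
have fZl c a b : f (c *: a) b = c *: f a b.
  by have := fl c a 0 b; rewrite f0l !addr0.
have fZr c a b : f a (c *: b) = c *: f a b.
  by have := fr c a b 0; rewrite f0r !addr0.
exists G => [a b|h hf].
  elim/malg_linind: a => [|x y Hx Hy|c x Hx|k].
  - by rewrite tensor0l linear0 f0l.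
  - by rewrite tensorDl linearD Hx Hy fDl.
  - by rewrite tensorZl fZl -Hx; exact: linearZ.
  elim/malg_linind: b => [|x y Hx Hy|c x Hx|l].
  - by rewrite tensor0r linear0 f0r.
  - by rewrite tensorDr linearD Hx Hy fDr.
  - by rewrite tensorZr fZr -Hx; exact: linearZ.
  by rewrite tensorU; exact: gU.
apply: malg_linear_ext => -[k l].
by rewrite -tensorU hf tensorU; exact: esym (gU (k, l)).
Qed.

Lemma multS_tensor a b : multS (a ⊗ b) = a * b.
Proof.
elim/malg_linind: a => [|x y Hx Hy|c x Hx|k].
- by rewrite tensor0l rmorph0 mul0r.
- by rewrite tensorDl rmorphD mulrDl /= Hx Hy.
- by rewrite tensorZl -[RHS]scalerAl -Hx; exact: linearZ.
elim/malg_linind: b => [|x y Hx Hy|c x Hx|l].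
- by rewrite tensor0r rmorph0 mulr0.
- by rewrite tensorDr rmorphD mulrDr /= Hx Hy.
- by rewrite tensorZr -[RHS]scalerAr -Hx; exact: linearZ.
rewrite tensorU; apply: etrans (mmapU _ _) _.
by rewrite /= scale1r; exact: mul1r.
Qed.

End TensorTheory.

Section Hopf.
Variable R : comNzRingType.

Definition piS : Sym R -> Sym R := symsubst (fun k => psum (2 * k)%N).

Definition comult : Sym R -> SymSym R :=
  symsubst (fun k => psum k ⊗ 1 + 1 ⊗ psum k).

Definition xi (a : Sym R) : Sym R := multS (comult a).

HB.instance Definition _ := GRing.LRMorphism.copy piS
  (symsubst (fun k => psum (2 * k)%N)).
HB.instance Definition _ := GRing.LRMorphism.copy comult
  (symsubst (fun k => psum k ⊗ 1 + 1 ⊗ psum k)).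
HB.instance Definition _ := GRing.LRMorphism.copy xi (@multS R \o comult).

Lemma piS_psum k : (0 < k)%N -> piS (psum k) = psum (2 * k)%N :> Sym R.
Proof. exact: symsubst_psum. Qed.

Lemma comult_psum k : (0 < k)%N ->
  comult (psum k) = psum k ⊗ 1 + 1 ⊗ psum k :> SymSym R.
Proof. exact: symsubst_psum. Qed.

Lemma xi_psum k : (0 < k)%N -> xi (psum k) = 2 *: psum k :> Sym R.
Proof.
move=> k0; rewrite /xi comult_psum //; move: (psum k) => p.
rewrite scaler_nat mulr2n; apply: etrans (rmorphD _ _ _) _; congr (_ + _).
  exact: etrans (multS_tensor _ _) (mulr1 _).
exact: etrans (multS_tensor _ _) (mul1r _).
Qed.

End Hopf.

Section InnerProducts.
Variable R : realType.

Definition zpart (kap : partition) : nat :=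
  (\prod_(i <- finsupp kap) (i.+1 ^ kap i * (kap i)`!))%N.

Definition zpartu (u : R) (kap : partition) : R :=
  (zpart kap)%:R * \prod_(i <- finsupp kap) (1 - u ^+ i.+1) ^- kap i.

(* The symmetric bilinear form for which the basis vectors << k >> are
   orthogonal, with squared norms w k. *)
Definition diagform (K : choiceType) (w : K -> R) (f g : {malg R[K]}) : R :=
  \sum_(k <- msupp f) f@_k * g@_k * w k.

(* <f, g>_u (see hl_inner_part). *)
Definition hl_inner (u : R) : Sym R -> Sym R -> R := diagform (zpartu u).

(* The product of <., .>_u and <., .>_v on the tensor product
   (see hl_inner2_tensor). *)
Definition hl_inner2 (u v : R) : SymSym R -> SymSym R -> R :=
  diagform (fun q => zpartu u q.1 * zpartu v q.2).

(* D is the linear map dual to a ⊗ b' |-> pi(a) b'; it exists and is unique when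
   0 < t < 1 (see twisted_comult_exists and twisted_comult_unique). *)
Definition is_twisted_comult (t : R) (D : {linear Sym R -> SymSym R}) : Prop :=
  forall b a b' : Sym R,
    hl_inner2 (t ^+ 2) (- t) (D b) (a ⊗ b') = hl_inner (- t) b (piS a * b').

Section DiagForm.
Variables (K : choiceType) (w : K -> R).
Implicit Types f g : {malg R[K]}.

Lemma diagformEw (d : {fset K}) f g : (msupp f `<=` d)%fset ->
  diagform w f g = \sum_(k <- d) f@_k * g@_k * w k.
Proof.
move=> le; rewrite [LHS](big_fset_incl _ le) //= => q _ /mcoeff_outdom ->.
by rewrite !mul0r.
Qed.

Lemma diagformC f g : diagform w f g = diagform w g f.
Proof.
set d := (msupp f `|` msupp g)%fset.
rewrite (@diagformEw d) ?(@diagformEw d g) ?fsubsetUl ?fsubsetUr //.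
by apply: eq_bigr => k _; rewrite (mulrC f@_k).
Qed.

Lemma diagformDr f g h :
  diagform w f (g + h) = diagform w f g + diagform w f h.
Proof.
rewrite /diagform -big_split; apply: eq_bigr => k _ /=.
by rewrite mcoeffD mulrDr mulrDl.
Qed.

Lemma diagformZr c f g : diagform w f (c *: g) = c * diagform w f g.
Proof.
rewrite /diagform mulr_sumr; apply: eq_bigr => k _.
by rewrite mcoeffZ mulrCA !mulrA.
Qed.

Lemma diagformDl f g h :
  diagform w (f + g) h = diagform w f h + diagform w g h.
Proof. by rewrite diagformC diagformDr !(diagformC h). Qed.

Lemma diagformZl c f g : diagform w (c *: f) g = c * diagform w f g.
Proof. by rewrite diagformC diagformZr (diagformC g). Qed.

Lemma diagform0r f : diagform w f 0 = 0.
Proof. by rewrite -(scale0r f) diagformZr mul0r. Qed.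

Lemma diagformUr f k : diagform w f << k >> = f@_k * w k.
Proof.
by rewrite diagformC /diagform msuppU oner_eq0 big_seq_fset1 mcoeffUU mul1r.
Qed.

End DiagForm.

Lemma hl_inner_part u (kap rho : partition) :
  hl_inner u << kap >> << rho >> = (kap == rho)%:R * zpartu u kap.
Proof.
rewrite /hl_inner diagformUr mcoeffU.
by case: eqP => [->|_]; rewrite ?mulr0n ?mul0r.
Qed.

Lemma hl_inner2_tensor u v a1 a2 b1 b2 :
  hl_inner2 u v (a1 ⊗ b1) (a2 ⊗ b2) = hl_inner u a1 a2 * hl_inner v b1 b2.
Proof.
elim/malg_linind: a2 => [|x y Hx Hy|c x Hx|k].
- by rewrite tensor0l /hl_inner2 /hl_inner !diagform0r mul0r.
- by rewrite tensorDl [LHS]diagformDr [in RHS]/hl_inner diagformDr mulrDl -Hx -Hy.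
- by rewrite tensorZl [LHS]diagformZr [in RHS]/hl_inner diagformZr -mulrA -Hx.
elim/malg_linind: b2 => [|x y Hx Hy|c x Hx|l].
- by rewrite tensor0r /hl_inner2 /hl_inner !diagform0r mulr0.
- by rewrite tensorDr [LHS]diagformDr [hl_inner v _ _]diagformDr mulrDr -Hx -Hy.
- by rewrite tensorZr [LHS]diagformZr [hl_inner v _ _]diagformZr mulrCA -Hx.
rewrite tensorU /hl_inner2 /hl_inner !diagformUr /=.
by rewrite mcoeff_tensor mulrACA.
Qed.

Lemma zpartu_gt0 u kap : -1 < u < 1 -> 0 < zpartu u kap.
Proof.
case/andP=> u_gt u_lt; have u1 : `|u| < 1 by rewrite ltr_norml u_gt u_lt.
apply: mulr_gt0; last first.
  apply: prodr_gt0 => i _; rewrite invr_gt0 exprn_gt0 // subr_gt0.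
  rewrite (le_lt_trans (ler_norm _)) // normrX.
  by rewrite exprn_ilt1.
rewrite ltr0n /zpart; apply: prodn_gt0 => i.
by rewrite muln_gt0 expn_gt0 fact_gt0.
Qed.

(* The finitely many divisors of the monomial p_kap. *)
Fact part_divisors (kap : partition) : exists d : {fset partition},
  forall del : partition, (forall i, (del i <= kap i)%N) -> del \in d.
Proof.
pose N := (\sum_(i <- finsupp kap) kap i)%N.
pose T := {ffun finsupp kap -> 'I_N.+1}.
pose F (f : T) : partition := [cmonom (f i : nat) | i : finsupp kap]%M.
exists [fset F f | f in T]%fset => del le.
have leN i : (del i <= N)%N.
  apply: leq_trans (le i) _; rewrite /N; case: mdomP => // ik.
  by rewrite (big_fsetD1 i) //= leq_addr.
apply/imfsetP; exists [ffun i => inord (del (val i))] => //=.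
apply/eqP/cmP => i; rewrite /F cmE fsfun_ffun.
case: insubP => [j ik <-|].
  by rewrite /= ffunE inordK ?ltnS.
rewrite -cmE_eq0 => /eqP ki; apply/eqP.
by rewrite /= -leqn0; apply: leq_trans (le i) _; rewrite ki.
Qed.

Fact piSU (mu : partition) : exists2 m : partition,
  piS << mu >> = << m >> :> Sym R & forall i, m (i.*2.+1) = mu i.
Proof.
have inj2 : injective (fun i => i.*2.+1) by move=> i j [/double_inj].
have [m Em mE] := prod_psum R mu inj2 (fset_uniq (finsupp mu)).
exists m => [|i]; last by rewrite (mE i); case: mdomP.
rewrite -Em; apply: etrans (symsubstU _ _) _; apply: eq_bigr => i _.
by rewrite mul2n doubleS.
Qed.

Fact twisted_support (kap : partition) :
  exists d : {fset partition * partition}, forall q,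
    piS << q.1 >> * << q.2 >> = << kap >> :> Sym R -> q \in d.
Proof.
have [d dP] := part_divisors kap.
pose half (del : partition) : partition :=
  [cmonom del i.*2.+1 | i in [fset j./2 | j in finsupp del]%fset]%M.
pose G (x y : partition) : (partition * partition)%type := (half x, y).
exists [fset G x y | x in d, y in d]%fset => -[mu nu] /=.
have [m -> mE] := piSU mu; rewrite -monalgUM => /(congr1 (mcoeff kap)).
rewrite [RHS]mcoeffUU mcoeffU1; case: eqP => [Ek _|_ /eqP]; last first.
  by rewrite eq_sym oner_eq0.
apply/imfset2P; exists m; first by apply: dP => i; rewrite -Ek cmM leq_addr.
exists nu; first by apply: dP => i; rewrite -Ek cmM leq_addl.
congr (_, _); apply/eqP/cmP => i; rewrite /half cmE fsfun_fun mE.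
case: ifPn => // /imfsetP nin; case: mdomP => // imu.
case: nin; exists i.*2.+1 => /=; last by rewrite uphalf_double.
by rewrite -cmE_neq0 mE cmE_neq0.
Qed.

Section TwistedComult.
Context (t : R) (t01 : 0 < t < 1).

Let w (q : partition * partition) := zpartu (t ^+ 2) q.1 * zpartu (- t) q.2.

Fact twisted_weight_neq0 q : w q != 0.
Proof.
case/andP: t01 => t0 t1; apply: lt0r_neq0; apply: mulr_gt0; apply: zpartu_gt0.
  rewrite (lt_trans _ (exprn_gt0 2 t0)) ?oppr_lt0 //=.
  by rewrite exprn_ilt1 // ltW.
by rewrite ltrN2 t1 (lt_trans _ (ltr01)) // oppr_lt0.
Qed.

Lemma twisted_comult_unique (D1 D2 : {linear Sym R -> SymSym R}) :
  is_twisted_comult t D1 -> is_twisted_comult t D2 -> D1 =1 D2.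
Proof.
move=> h1 h2 b; apply/malgP => -[k l].
have := h1 b << k >> << l >>; rewrite -(h2 b << k >> << l >>) tensorU.
by rewrite /hl_inner2 !diagformUr => /(mulIf (twisted_weight_neq0 (k, l))).
Qed.

Lemma twisted_comult_exists :
  exists D : {linear Sym R -> SymSym R}, is_twisted_comult t D.
Proof.
pose c kap q := hl_inner (- t) << kap >> (piS << q.1 >> * << q.2 >>) / w q.
have [F FP] : exists F : partition -> {fset partition * partition},
    forall kap q, c kap q != 0 -> q \in F kap.
  suff /boolp.choice[F FP] : forall kap, exists d : {fset partition * partition},
      forall q, c kap q != 0 -> q \in d by exists F.
  move=> kap; have [d dP] := twisted_support kap.
  exists d => q cq; apply: dP; move: cq; rewrite /c.
  have [m -> _] := piSU q.1; rewrite -monalgUM hl_inner_part.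
  by case: (kap =P _) => [<- //|_]; rewrite mulr0n 2!mul0r => /eqP[].
pose D (b : Sym R) : SymSym R :=
  \sum_(kap <- msupp b) \sum_(q <- F kap) << b@_kap * c kap q *g q >>.
have DE b q : (D b)@_q = hl_inner (- t) b (piS << q.1 >> * << q.2 >>) / w q.
  rewrite /D raddf_sum /= {1}/hl_inner.
  have -> : diagform (zpartu (- t)) b (piS << q.1 >> * << q.2 >>) / w q
          = \sum_(kap <- msupp b) b@_kap * c kap q.
    have [m Em _] := piSU q.1; rewrite /c Em -monalgUM /diagform mulr_suml.
    apply: eq_bigr => kap _; rewrite hl_inner_part mcoeffU1 eq_sym.
    by rewrite !mulrA.
  apply: eq_bigr => kap _; rewrite raddf_sum /=.
  have [qF|qnF] := boolP (q \in F kap); last first.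
    rewrite big1_fset => [|q' q'F _].
      by apply/esym/eqP; rewrite mulf_eq0; apply/orP; right;
         apply: contraNT qnF => /FP.
    by rewrite mcoeffU; case: eqP q'F qnF => // -> ->.
  rewrite (big_fsetD1 q qF).
  rewrite big1_fset => [|q'].
    by rewrite /= addr0 mcoeffUU.
  by rewrite in_fsetD1 mcoeffU; case: eqP.
clearbody D; have DP : linear D.
  move=> r x y; apply/malgP => q; rewrite [RHS]mcoeffD mcoeffZ !DE.
  by rewrite /hl_inner diagformDl diagformZl mulrDl mulrA.
pose DL : {linear Sym R -> SymSym R} :=
  HB.pack D (GRing.isLinear.Build R (Sym R) (SymSym R) *:%R D DP).
exists DL => b a b'; change (DL b) with (D b).
move: (D b) (DE b) => X XE; rewrite /hl_inner2 /hl_inner in XE *.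
elim/malg_linind: a => [|x y Hx Hy|r x Hx|k].
- by rewrite tensor0l rmorph0 mul0r !diagform0r.
- rewrite tensorDl rmorphD /= mulrDl [LHS]diagformDr [RHS]diagformDr.
  by congr (_ + _); [exact: Hx|exact: Hy].
- rewrite tensorZl linearZ /= -[_ * b']scalerAl [LHS]diagformZr [RHS]diagformZr.
  by congr (_ * _); exact: Hx.
move Ek: << k >> => u.
elim/malg_linind: b' => [|x y Hx Hy|r x Hx|l].
- by rewrite tensor0r mulr0 !diagform0r.
- rewrite tensorDr mulrDr [LHS]diagformDr [RHS]diagformDr.
  by congr (_ + _); [exact: Hx|exact: Hy].
- rewrite tensorZr -[_ * (r *: x)]scalerAr [LHS]diagformZr [RHS]diagformZr.
  by congr (_ * _); exact: Hx.
rewrite -Ek tensorU; apply: etrans (diagformUr _ _ _) _.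
by rewrite (XE (k, l)) /= mulfVK // twisted_weight_neq0.
Qed.

End TwistedComult.

End InnerProducts.

(* Main.v *)
(* On Sym with <.,.>_u, multiplication by p_k is adjoint to
   k / (1 - u^k) d/dp_k.  Since d/dp_{2k} is a derivation with
   d/dp_{2k} (pi a) = pi (d/dp_k a), and the adjointness constant
   2k / (1 - t^{2k}) of p_{2k} in B is twice that of p_k in A, dualizing gives
   D (p_{2k} b) = (2 p_k ⊗ 1 + 1 ⊗ p_{2k}) D b for D the twisted
   comultiplication.  The first factor is the image of p_k under the algebra
   morphism (xi ⊗ pi) o Delta, so D (pi(a) b) = (xi ⊗ pi)(Delta a) D b for every
   a, because the set of such a is a subalgebra. *)
Require Import Defs.
From HB Require Import structures.
From mathcomp Require Import all_boot all_order all_algebra.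
From mathcomp Require Import finmap monalg reals.

Set Implicit Arguments.
Unset Strict Implicit.
Unset Printing Implicit Defensive.

Import Order.TTheory GRing.Theory Num.Theory.

Local Open Scope ring_scope.

(** * Removing one part from a partition, and induction on generators *)

Lemma divcm_ucmM i (m : {cmonom nat}) : divcm (mmul (ucm i) m) (ucm i) = m.
Proof. by apply/eqP/cmP => j; rewrite divcmE cmM addKn. Qed.

Lemma ucmM_divcm i (m : {cmonom nat}) :
  m i != 0%N -> mmul (ucm i) (divcm m (ucm i)) = m.
Proof.
move=> mi; apply/eqP/cmP => j; rewrite cmM divcmE subnKC // cmU.
by case: eqP => [<-|]; rewrite ?lt0n.
Qed.

Lemma divcmM_ucm i (m n : {cmonom nat}) :
  n i != 0%N -> divcm (mmul m n) (ucm i) = mmul m (divcm n (ucm i)).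
Proof.
move=> ni; rewrite -{1}(ucmM_divcm ni).
by rewrite mulmA (mulmC m) -mulmA divcm_ucmM.
Qed.

Lemma monalgU_inj (R : comNzRingType) (K : choiceType) (k l : K) :
  << k >> = << l >> :> {malg R[K]} -> k = l.
Proof.
move/(congr1 (mcoeff k)); rewrite mcoeffUU mcoeffU.
by case: eqP => // _ /eqP; rewrite mulr0n oner_eq0.
Qed.

Lemma psumMU (R : comNzRingType) i (m : {cmonom nat}) :
  psum i.+1 * << m >> = << mmul (ucm i) m >> :> Sym R.
Proof. exact: esym (monalgUM R (ucm i) m). Qed.

(** The power sums generate [Sym R] as an algebra: each basis vector is a product of them by
    [psum_partE]. The zero vector is reached as [0 *: 1]. *)
Lemma psum_ind (R : comNzRingType) (P : Sym R -> Prop) :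
    (forall x y, P x -> P y -> P (x + y)) -> (forall c x, P x -> P (c *: x)) ->
    P 1 -> (forall x y, P x -> P y -> P (x * y)) -> (forall i, P (psum i.+1)) ->
  forall x, P x.
Proof.
move=> PD PZ P1 PM Pp; elim/malg_linind => [|||kap]; [|exact: PD|exact: PZ|].
  by rewrite -(scale0r 1); exact: PZ.
rewrite psum_partE; elim/big_ind: _ => [||i _]; [exact: P1|exact: PM|].
elim: (kap i) => [|n IH]; first exact: P1.
by rewrite exprS; apply: PM; [exact: Pp|exact: IH].
Qed.

Lemma piS_psumS (R : comNzRingType) j :
  piS (psum j.+1) = psum j.+1.*2 :> Sym R.
Proof. exact: etrans (piS_psum R (ltn0Sn j)) (congr1 psum (mul2n j.+1)). Qed.

Lemma tensor11 (R : comNzRingType) : 1 ⊗ 1 = 1 :> SymSym R.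
Proof. exact: tensorU. Qed.

Lemma tensor_linind (R : comNzRingType) (P : SymSym R -> Prop) :
    (forall x y, P x -> P y -> P (x + y)) -> (forall c x, P x -> P (c *: x)) ->
    (forall a b, P (a ⊗ b)) ->
  forall x, P x.
Proof.
move=> PD PZ PT; elim/malg_linind => [|||[k l]]; [|exact: PD|exact: PZ|].
  by rewrite -(tensor0l 0); exact: PT.
by rewrite -tensorU; exact: PT.
Qed.

(** * The algebra endomorphism xi ⊗ pi *)

Section Action.
Variable R : comNzRingType.

Lemma linear_mul_closed (A B : comAlgType R) (g : {linear A -> B}) (z : A) :
  (forall x y, g (x * z) = g x * g z -> g (y * z) = g y * g z ->
     g ((x + y) * z) = g (x + y) * g z) /\
  (forall c x, g (x * z) = g x * g z -> g ((c *: x) * z) = g (c *: x) * g z).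
Proof.
split=> [x y Hx Hy|c x Hx]; first by rewrite mulrDl !linearD /= mulrDl Hx Hy.
by rewrite -scalerAl !linearZ /= -scalerAl Hx.
Qed.

(** The linear map comes from the universal property of the tensor product. Multiplicativity is
    bilinear in the two arguments, so it reduces to pure tensors, where [xi] and [piS] are ring
    morphisms. *)
Lemma xi_piS_tensor_exists :
  exists2 g : {linear SymSym R -> SymSym R},
    forall a b, g (a ⊗ b) = xi a ⊗ piS b & {morph g : x y / x * y}.
Proof.
have [||g gE _] := @tensor_universal R (SymSym R) (fun a b => xi a ⊗ piS b).
- by move=> c a a' b; rewrite linearP tensorDl tensorZl.
- by move=> c a b b'; rewrite linearP tensorDr tensorZr.
exists g; first exact: gE.
move=> x z; have [gD gZ] := linear_mul_closed g z.
elim/tensor_linind: x => [|| a b]; [exact: gD|exact: gZ|].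
have [gD' gZ'] := linear_mul_closed g (a ⊗ b).
(* Swapping the factors makes the closure facts, stated for the left factor, apply to [z]. *)
rewrite mulrC [RHS]mulrC.
elim/tensor_linind: z {gD gZ} => [|| a' b']; [exact: gD'|exact: gZ'|].
rewrite tensorM !gE [RHS]tensorM.
by congr (_ ⊗ _); exact: rmorphM.
Qed.

End Action.

(** Quantifying over [y] inside [P] is what gives closure under products: the hypothesis on [x] is
    used at [f y * z]. *)
Lemma intertwine_closed (R : comNzRingType) (A B C S : comAlgType R)
    (f : {lrmorphism A -> B}) (c : {lrmorphism A -> S}) (g : {linear S -> C})
    (D : {linear B -> C}) (gM : {morph g : x y / x * y}) (g1 : g 1 = 1)
    (P := fun x => forall y, D (f x * y) = g (c x) * D y) :
  [/\ forall x y, P x -> P y -> P (x + y), forall d x, P x -> P (d *: x),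
      P 1 & forall x y, P x -> P y -> P (x * y)].
Proof.
rewrite /P; split=> [x y Hx Hy z|d x Hx z|z|x y Hx Hy z].
- by rewrite !linearD /= !mulrDl linearD Hx Hy.
- by rewrite !linearZ /= -!scalerAl linearZ /= Hx.
- by rewrite !rmorph1 g1 !mul1r.
- by rewrite !rmorphM gM -!mulrA Hx Hy.
Qed.

(** * Adjoints of multiplication by power sums *)

Section Adjoint.
Variable R : realType.
Implicit Types (u v : R) (k l m n : {cmonom nat}).

(* The adjoint of multiplication by p_{i+1} is [psum_adj u i] times the
   derivation with respect to p_{i+1}. *)
Definition psum_adj u i : R := i.+1%:R / (1 - u ^+ i.+1).

Lemma zpartuEw u m (d : {fset nat}) : (finsupp m `<=` d)%fset ->
  zpartu u m =
    \prod_(i <- d) ((i.+1 ^ m i * (m i)`!)%:R * (1 - u ^+ i.+1) ^- m i).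
Proof.
move=> le; rewrite /zpartu /zpart natr_prod -big_split /=.
apply: big_fset_incl le _ => i _.
by rewrite -cmE_eq0 => /eqP->; rewrite mul1r expr0 invr1.
Qed.

(** Only the factor at [i] of the product changes. Its factorial contributes [(m i).+1], and the two
    powers together contribute [psum_adj u i]. *)
Lemma zpartu_ucmM u i m :
  zpartu u (mmul (ucm i) m) = (m i).+1%:R * psum_adj u i * zpartu u m.
Proof.
pose d := (i |` finsupp m)%fset.
have id_ : i \in d by rewrite fset1U1.
rewrite (@zpartuEw _ _ d) ?mdomD ?mdomU //.
rewrite (@zpartuEw _ m d) ?fsubsetUr //.
rewrite (big_fsetD1 i) //= [X in _ = _ * X](big_fsetD1 i) //= mulrA.
congr (_ * _); last first.
  apply: eq_big_seq => j; rewrite in_fsetD1 => /andP[ji _].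
  by rewrite cmM cmU eq_sym (negbTE ji).
rewrite cmM cmUU add1n factS expnS exprS invfM /psum_adj.
rewrite mulnACA natrM (mulnC _ (m i).+1) natrM.
by rewrite [LHS]mulrACA !mulrA.
Qed.

Lemma diagform_mul_closed (K : conomType) (w : K -> R) (p h h' : {malg R[K]})
    (c : R) (P := fun f => diagform w (p * f) h = c * diagform w f h') :
  [/\ P 0, (forall x y, P x -> P y -> P (x + y)) & forall d x, P x -> P (d *: x)].
Proof.
rewrite /P; split=> [|x y Hx Hy|d x Hx].
- by rewrite mulr0 ![diagform _ 0 _]diagformC !diagform0r mulr0.
- by rewrite mulrDr !diagformDl Hx Hy mulrDr.
- by rewrite -scalerAr !diagformZl Hx mulrCA.
Qed.

(** Adjointness on basis vectors: both sides vanish unless [n] is [m] with one more part [i.+1]. If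
    [n i] is 0, the truncated [divcm] returns [n] itself, and the factor [n i] kills that term. *)
Lemma zpartu_adjoint u i m n :
  (mmul (ucm i) m == n)%:R * zpartu u (mmul (ucm i) m) =
    (n i)%:R * psum_adj u i * ((m == divcm n (ucm i))%:R * zpartu u m).
Proof.
have [ni|ni] := eqVneq (n i) 0%N.
  rewrite ni !mul0r; case: eqP => [En|_]; last by rewrite mul0r.
  by move: ni; rewrite -En cmM cmUU.
case: (m =P _) => [Em|nm].
  rewrite Em ucmM_divcm // eqxx !mul1r -{1}(ucmM_divcm ni) zpartu_ucmM.
  by rewrite divcmE cmUU subn1 prednK // lt0n.
case: eqP => [En|_]; last by rewrite !mul0r mulr0.
by case: nm; rewrite -En divcm_ucmM.
Qed.

(** The vector [(n i)%:R *: << divcm n (ucm i) >>] is the derivative of [<< n >>] with respect to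
    p_{i+1}. *)
Lemma psum_adjoint u i f n :
  hl_inner u (psum i.+1 * f) << n >> =
    (n i)%:R * psum_adj u i * hl_inner u f << divcm n (ucm i) >>.
Proof.
have [P0 PD PZ] := diagform_mul_closed (zpartu u) (psum i.+1) << n >>
  << divcm n (ucm i) >> ((n i)%:R * psum_adj u i).
elim/malg_linind: f => [|||m]; [exact P0|exact PD|exact PZ|].
have E1 := hl_inner_part u (mmul (ucm i) m) n.
have E2 := hl_inner_part u m (divcm n (ucm i)).
rewrite psumMU; apply: etrans E1 _.
by rewrite zpartu_adjoint; congr (_ * _); exact (esym E2).
Qed.

Lemma hl_inner2_psuml u v i F k g :
  hl_inner2 u v ((psum i.+1 ⊗ 1) * F) (<< k >> ⊗ g) =
    (k i)%:R * psum_adj u i * hl_inner2 u v F (<< divcm k (ucm i) >> ⊗ g).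
Proof.
have [_ PD PZ] := diagform_mul_closed
  (fun q => zpartu u q.1 * zpartu v q.2) (psum i.+1 ⊗ 1)
  (<< k >> ⊗ g) (<< divcm k (ucm i) >> ⊗ g) ((k i)%:R * psum_adj u i).
elim/tensor_linind: F => [||a b]; [exact: PD|exact: PZ|].
rewrite tensorM; apply: etrans (hl_inner2_tensor _ _ _ _ _ _) _.
rewrite psum_adjoint -mulrA; congr (_ * _).
have -> : 1 * b = b := mul1r b.
exact (esym (hl_inner2_tensor _ _ _ _ _ _)).
Qed.

Lemma hl_inner2_psumr u v i F f l :
  hl_inner2 u v ((1 ⊗ psum i.+1) * F) (f ⊗ << l >>) =
    (l i)%:R * psum_adj v i * hl_inner2 u v F (f ⊗ << divcm l (ucm i) >>).
Proof.
have [_ PD PZ] := diagform_mul_closed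
  (fun q => zpartu u q.1 * zpartu v q.2) (1 ⊗ psum i.+1)
  (f ⊗ << l >>) (f ⊗ << divcm l (ucm i) >>) ((l i)%:R * psum_adj v i).
elim/tensor_linind: F => [||a b]; [exact: PD|exact: PZ|].
rewrite tensorM; apply: etrans (hl_inner2_tensor _ _ _ _ _ _) _.
rewrite (psum_adjoint v) mulrCA; congr (_ * _).
have -> : 1 * a = a := mul1r a.
exact (esym (hl_inner2_tensor _ _ _ _ _ _)).
Qed.

(** With k = j+1, the index [j.*2.+1] stands for p_{2k}, and (-t)^{2k} = (t^2)^k, so the
    denominators agree. This is the source of the factor 2 in [xi]. *)
Lemma psum_adj_double (t : R) j :
  psum_adj (- t) j.*2.+1 = 2 * psum_adj (t ^+ 2) j.
Proof.
by rewrite /psum_adj -doubleS -mul2n natrM exprM sqrrN mulrA.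
Qed.

(** Monomial form of d/dp_{2j+2} (pi a) = pi (d/dp_{j+1} a): [piS] sends the removed factor p_{j+1}
    to p_{2j+2}. *)
Lemma piS_divcm j k m m' : k j != 0%N -> piS << k >> = << m >> :> Sym R ->
  piS << divcm k (ucm j) >> = << m' >> :> Sym R -> m = mmul (ucm j.*2.+1) m'.
Proof.
move=> kj Em Em'; apply: (@monalgU_inj R); rewrite -Em -psumMU -Em'.
rewrite -{1}(ucmM_divcm kj) -psumMU.
apply: etrans (rmorphM _ _ _) _; congr (_ * _).
exact: piS_psumS.
Qed.

Lemma piS_mulU k m l : piS << k >> = << m >> :> Sym R ->
  piS << k >> * << l >> = << mmul m l >> :> Sym R.
Proof. by move=> ->; exact (esym (monalgUM R m l)). Qed.

(** * The twisted comultiplication of a multiple of p_{2k} *)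

Section TwistedComult.
Variables (t : R) (D : {linear Sym R -> SymSym R}).
Hypotheses (t01 : 0 < t < 1) (DP : is_twisted_comult t D).

Lemma twisted_comult_psum j b :
  D (psum j.+1.*2 * b) =
    (2 *: (psum j.+1 ⊗ 1) + 1 ⊗ psum j.+1.*2) * D b.
Proof.
(* A coefficient times its nonzero weight is a pairing with [<< k >> ⊗ << l >>], which brings in the
   duality [DP]. *)
apply/malgP => -[k l]; apply: (mulIf (twisted_weight_neq0 t01 (k, l))).
have wE F : F@_(k, l) * (zpartu (t ^+ 2) k * zpartu (- t) l)
          = hl_inner2 (t ^+ 2) (- t) F (<< k >> ⊗ << l >>).
  by rewrite tensorU; exact (esym (diagformUr _ _ (k, l))).
apply: etrans (wE _) (etrans _ (esym (wE _))); rewrite {wE} doubleS.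
apply: etrans (DP _ _ _) _.
rewrite mulrDl -scalerAl; apply: etrans _ (esym (diagformDl _ _ _ _)).
set X := diagform _ _ _; set Y := diagform _ _ _.
have -> : X = 2 * ((k j)%:R * psum_adj (t ^+ 2) j *
    hl_inner (- t) b (piS << divcm k (ucm j) >> * << l >>)).
  rewrite -DP -hl_inner2_psuml; exact (diagformZl _ _ _ _).
have -> : Y = (l j.*2.+1)%:R * psum_adj (- t) j.*2.+1 *
    hl_inner (- t) b (piS << k >> * << divcm l (ucm j.*2.+1) >>).
  rewrite -DP; exact (hl_inner2_psumr _ _ _ _ _ _).
move=> {X Y}; have [m Em mE] := piSU R k.
apply: etrans (congr1 (hl_inner _ _) (piS_mulU l Em)) _.
apply: etrans (psum_adjoint _ _ _ _) _.
(* Leibniz rule: the exponent of p_{2j+2} in the product is the sum of those in [<< m >>] and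
   [<< l >>]. The two summands match the two terms of the multiplier. *)
rewrite cmM natrD 2![in LHS]mulrDl; congr (_ + _).
  rewrite mE; have [->|kj] := eqVneq (k j) 0%N; first by rewrite !mul0r mulr0.
  have [m' Em' _] := piSU R (divcm k (ucm j)).
  rewrite (piS_divcm kj Em Em').
  rewrite -mulmA divcm_ucmM psum_adj_double (mulrCA _ 2) -[LHS]mulrA.
  congr (_ * (_ * _)); exact (congr1 (hl_inner _ _) (esym (piS_mulU l Em'))).
have [->|li] := eqVneq (l j.*2.+1) 0%N; first by rewrite !mul0r.
rewrite (divcmM_ucm m li); congr (_ * _).
exact (congr1 (hl_inner _ _) (esym (piS_mulU _ Em))).
Qed.

End TwistedComult.
End Adjoint.

Theorem theorem6p1 (R : realType) (t : R) (t01 : 0 < t < 1)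
    (tcomult : {linear Sym R -> SymSym R}) (tcomultP : is_twisted_comult t tcomult)
    (a b : Sym R) (da db : seq (Sym R * Sym R))
    (da_eq : comult a = \sum_(x <- da) x.1 ⊗ x.2)
    (db_eq : tcomult b = \sum_(y <- db) y.1 ⊗ y.2) :
  tcomult (piS a * b) =
    \sum_(x <- da) \sum_(y <- db) (xi x.1 * y.1) ⊗ (piS x.2 * y.2).
Proof.
have [g gE gM] := xi_piS_tensor_exists R.
have g11 : g 1 = 1.
  by rewrite -tensor11 gE; congr (_ ⊗ _); exact: rmorph1.
have [PD PZ P1 PM] := @intertwine_closed R (Sym R) (Sym R) (SymSym R)
  (SymSym R) (@piS R) (@comult R) g tcomult gM g11.
have key x y : tcomult (piS x * y) = g (comult x) * tcomult y.
  (* By closure under the algebra operations, only [x] = p_{i+1} remains, where [g] sends its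
     coproduct to the multiplier of [twisted_comult_psum]. *)
  elim/psum_ind: x y => [||||i]; [exact PD|exact PZ|exact P1|exact PM|] => y.
  rewrite piS_psumS (twisted_comult_psum t01 tcomultP); congr (_ * _).
  rewrite (comult_psum R (ltn0Sn i)); apply: etrans _ (esym (linearD g _ _)).
  congr (_ + _); apply: etrans _ (esym (gE _ _)).
    rewrite (xi_psum R (ltn0Sn i)) tensorZl; congr (_ *: (_ ⊗ _)).
    exact (esym (rmorph1 _)).
  by rewrite piS_psumS; congr (_ ⊗ _); exact (esym (rmorph1 _)).
rewrite key da_eq db_eq linear_sum mulr_suml; apply: eq_bigr => x _.
by rewrite mulr_sumr; apply: eq_bigr => y _; rewrite gE tensorM.
Qed.
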